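(* Let $G$ be a group containing a non-abelian free group. For every state $\tau$ on $\ell^\infty(G)$, every Hilbert space $\mathcal{H}$, and every small enough $\varepsilon>0$ (i.e. there is $\varepsilon_0>0$ such that the following holds for all $0<\varepsilon<\varepsilon_0$), there exists an $\varepsilon$-representation $\varphi\colon G\to U(\mathcal{H})$ such that for every positive definite map $\psi\colon G\to B(\mathcal{H})$ there exists a normal linear functional $\Phi$ on $B(\mathcal{H})$ such that $$\Phi(\varphi(x)^*\psi(x))\neq\tau_y\,\Phi(\varphi(x)^*\varphi(xy)\varphi(y)^* )$$ for some $x\in G$.
   Context: Groups are discrete. $B(\mathcal{H})$ is the algebra of bounded operators with the operator norm and $U(\mathcal{H})$ its unitary group. For $\varepsilon\geq 0$, a map $\varphi\colon G\to B(\mathcal{H})$ is an $\varepsilon$-representation if $\|\varphi(xy)-\varphi(x)\varphi(y)\|\leq\varepsilon$ for all $x,y\in G$. A map $\psi\colon G\to B(\mathcal{H})$ is positive definite if for every finite set $\{x_1,\dots,x_n\}\subset G$ the operator matrix $(\psi(x_i^{-1}x_j))_{ij}$ is positive. $\ell^\infty(G)$ is the algebra of bounded complex functions on $G$; $\tau_y f(y)$ denotes $\tau$ applied to the bounded function $y\mapsto f(y)$. Normal means ultraweakly continuous.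
   Formalization: The Hilbert space H is assumed nonzero: for H = 0 every linear functional Φ on B(H) vanishes, both sides are 0, and the claimed inequality fails. *)

(* Defs.v *)
From HB Require Import structures.
From mathcomp Require Import all_boot all_order all_algebra sesquilinear.
From mathcomp Require Import all_classical all_reals all_analysis.
From mathcomp Require Import complex.

Set Implicit Arguments.
Unset Strict Implicit.
Unset Printing Implicit Defensive.

Import Order.TTheory GRing.Theory Num.Theory numFieldNormedType.Exports.

Local Open Scope classical_set_scope.
Local Open Scope complex_scope.
Local Open Scope ring_scope.

(* The inner product is linear in its first argument and conjugate linear in
   the second. *)

HB.mixin Record CompleteNormedModule_isHilbert (R : realType) (H : Type)
    of CompleteNormedModule R[i] H := {
  inner : {dot H for (@Num.conj R[i])};
  inner_norm : forall v : H, inner v v = `|v| ^+ 2 }.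

#[short(type="hilbertType")]
HB.structure Definition Hilbert (R : realType) :=
  {H of CompleteNormedModule R[i] H & CompleteNormedModule_isHilbert R H}.

Notation "'⟨' u , v '⟩'" := (inner u v) (at level 0, format "'⟨' u ,  v '⟩'").

Section BoundedOperators.
Variables (R : realType) (H : hilbertType R).

(* For linear maps, continuous and bounded are the same
   (linear_bounded_continuous). *)
Definition bounded_operator : {pred H -> H} :=
  [pred f | `[< linear f /\ continuous f >]].

Lemma bounded_operator_submod : submod_closed bounded_operator.
Proof.
split.
  apply/asboolP; split=> [a u v|]; first by rewrite scaler0 addr0.
  exact: cst_continuous.
move=> a f g /asboolP[lf cf] /asboolP[lg cg]; apply/asboolP; split.
  move=> b u v /=.
  have E w : (a *: f + g) w = a *: f w + g w by [].
  rewrite !E lf lg !scalerDr !scalerA (mulrC a b).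
  by rewrite addrACA.
move=> v; apply: (@cvgD _ _ _ (nbhs v) _ (fun w => a *: f w) g).
  exact: cvgZr (cf v).
exact: cg.
Qed.

HB.instance Definition _ :=
  GRing.isSubmodClosed.Build R[i] (H -> H) bounded_operator
    bounded_operator_submod.

Record Bop := MkBop { Bop_fun :> H -> H; Bop_funP : Bop_fun \in bounded_operator }.

HB.instance Definition _ := [isSub for Bop_fun].
HB.instance Definition _ := [Choice of Bop by <:].
HB.instance Definition _ := [SubChoice_isSubLmodule of Bop by <:].

Lemma Bop_id_subproof : idfun \in bounded_operator.
Proof. by apply/asboolP; split=> // v; exact: cvg_id. Qed.

Lemma Bop_comp_subproof (S T : Bop) : S \o T \in bounded_operator.
Proof.
case: S T => [s /= /asboolP[ls cs]] [t /= /asboolP[lt ct]].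
apply/asboolP; split=> [a u v|v] /=; first by rewrite lt ls.
by apply: (@continuous_comp _ _ _ t s); [exact: ct|exact: cs].
Qed.

Definition Bop_id : Bop := MkBop Bop_id_subproof.
Definition Bop_comp (S T : Bop) : Bop := MkBop (Bop_comp_subproof S T).

Lemma Bop_linear (T : Bop) : linear T.
Proof. by case: T => t /= /asboolP[]. Qed.

Lemma Bop_compA : associative Bop_comp.
Proof. by move=> S T U; exact: val_inj. Qed.
Lemma Bop_comp1 : left_id Bop_id Bop_comp.
Proof. by move=> T; exact: val_inj. Qed.
Lemma Bop_1comp : right_id Bop_id Bop_comp.
Proof. by move=> T; exact: val_inj. Qed.
Lemma Bop_compDl : left_distributive Bop_comp +%R.
Proof. by move=> S T U; exact: val_inj. Qed.
Lemma Bop_compDr : right_distributive Bop_comp +%R.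
Proof.
move=> S T U; apply: val_inj; apply/funext => v /=.
have := Bop_linear S 1 (T v) (U v); rewrite !scale1r => SD.
exact: SD.
Qed.

HB.instance Definition _ := GRing.Zmodule_isPzRing.Build Bop
  Bop_compA Bop_comp1 Bop_1comp Bop_compDl Bop_compDr.

Definition opnorm (T : Bop) : R :=
  sup [set complex.Re `|T v| | v in [set v : H | `|v| <= 1]].

(* Every bounded operator has exactly one adjoint (Riesz), so the default
   value 0 is never used. *)
Definition adjoint (T : Bop) : Bop :=
  xget 0 [set S : Bop | forall u v, ⟨T u, v⟩ = ⟨u, S v⟩].

Definition unitary (U : Bop) : Prop :=
  adjoint U * U = 1 /\ U * adjoint U = 1.

(* Positivity of an operator matrix, as an operator on the Hilbert space
   H^n, whose inner product is the sum of those of the coordinates. *)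
Definition positive_opmx n (A : 'M[Bop]_n) : Prop :=
  forall v : 'I_n -> H, 0 <= \sum_i ⟨\sum_j A i j (v j), v i⟩.

(* The ultraweak topology on B(H) is the coarsest one making all functionals
   T |-> \sum_k <T xi_k, eta_k>, with \sum_k |xi_k|^2 and \sum_k |eta_k|^2
   finite, continuous. *)

Record ell2_pair := MkEll2Pair {
  xi : nat -> H;
  eta : nat -> H;
  xi_ell2 : cvgn (series (fun k => `|xi k| ^+ 2 : R[i]^o));
  eta_ell2 : cvgn (series (fun k => `|eta k| ^+ 2 : R[i]^o)) }.

Definition ell2_functional (p : ell2_pair) (T : Bop) : R[i]^o :=
  limn (series (fun k => ⟨T (xi p k), eta p k⟩ : R[i]^o)).

Definition ultraweak : Type := sup_topology (fun p : ell2_pair =>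
  Topological.class (initial_topology (ell2_functional p))).

HB.instance Definition _ := Topological.on ultraweak.

Definition normal_functional (Phi : {scalar Bop}) : Prop :=
  continuous (Phi : ultraweak -> R[i]^o).

End BoundedOperators.

Section MapsIntoBop.
Variables (G : groupType) (R : realType) (H : hilbertType R).
Implicit Types phi psi : G -> Bop H.

Definition eps_representation (eps : R) phi : Prop :=
  forall x y : G, opnorm (phi (x * y)%g - phi x * phi y) <= eps.

Definition positive_definite psi : Prop :=
  forall n (x : 'I_n -> G), injective x ->
    positive_opmx (\matrix_(i, j) psi ((x i)^-1 * x j)%g).

End MapsIntoBop.

Section BoundedFunctions.
Variables (G : Type) (R : realType).

Definition bounded_function : {pred G -> R[i]^o} :=
  [pred f | `[< exists M : R[i], forall y, `|f y| <= M >]].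

Lemma bounded_function_submod : submod_closed bounded_function.
Proof.
split; first by apply/asboolP; exists 0 => y; rewrite normr0.
move=> a f g /asboolP[M fM] /asboolP[N gN]; apply/asboolP.
exists (`|a| * M + N) => y; apply: le_trans (ler_normD _ _) _.
by rewrite lerD// normrM ler_wpM2l.
Qed.

HB.instance Definition _ :=
  GRing.isSubmodClosed.Build R[i] (G -> R[i]^o) bounded_function
    bounded_function_submod.

Lemma bounded_function_mul : mulr_closed bounded_function.
Proof.
split; first by apply/asboolP; exists 1 => y; rewrite normr1.
move=> f g /asboolP[M fM] /asboolP[N gN]; apply/asboolP.
by exists (M * N) => y; rewrite normrM ler_pM.
Qed.

HB.instance Definition _ :=
  GRing.isMulClosed.Build (G -> R[i]^o) bounded_function bounded_function_mul.

Record linf := MkLinf {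
  linf_fun :> G -> R[i]^o; linf_funP : linf_fun \in bounded_function }.

HB.instance Definition _ := [isSub for linf_fun].
HB.instance Definition _ := [Choice of linf by <:].
HB.instance Definition _ := [SubChoice_isSubLmodule of linf by <:].
HB.instance Definition _ :=
  GRing.SubZmodule_isSubPzRing.Build _ _ linf (subringClosedP _).
HB.instance Definition _ :=
  GRing.SubPzRing_isSubComPzRing.Build _ _ linf.

(* A positive functional on a unital C*-algebra has norm its value at 1. *)
Definition is_state (tau : {scalar linf}) : Prop :=
  (forall f : linf, (forall y, 0 <= f y) -> 0 <= tau f) /\ tau 1 = 1.

End BoundedFunctions.

(* The letter (false, s) stands for s and the letter (true, s) for its
   inverse. *)

Section FreeSubgroups.
Variable G : groupType.

Definition letter_val (l : bool * G) : G := if l.1 then (l.2^-1)%g else l.2.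

Definition word_val (w : seq (bool * G)) : G :=
  foldr (fun l g => (letter_val l * g)%g) 1%g w.

Definition word_over (S : set G) (w : seq (bool * G)) : Prop :=
  forall l, l \in w -> S l.2.

Definition reduced (w : seq (bool * G)) : bool :=
  sorted (fun l m => ~~ ((l.2 == m.2) && (l.1 != m.1))) w.

Definition generated_subgroup (S : set G) : set G :=
  [set word_val w | w in word_over S].

Definition free_family (S : set G) : Prop :=
  forall w, word_over S w -> reduced w -> w != [::] -> word_val w <> 1%g.

(* F is free on S: S generates F and no nonempty reduced word in S is
   trivial. *)
Definition free_subgroup (F : set G) : Prop :=
  exists2 S : set G, free_family S & F = generated_subgroup S.

Definition nonabelian (F : set G) : Prop :=
  exists x y, [/\ F x, F y & (x * y)%g <> (y * x)%g].

Definition contains_nonabelian_free_group : Prop :=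
  exists2 F : set G, free_subgroup F & nonabelian F.

End FreeSubgroups.

(* Main.v *)
From HB Require Import structures.
Require Import Defs.
From mathcomp Require Import all_boot all_order all_algebra sesquilinear.
From mathcomp Require Import all_classical all_reals all_analysis.
From mathcomp Require Import complex ring lra.

(** Small perturbations of the trivial character suffice.  Write i for the
    imaginary unit, and fix a set A in G and a unit complex number
    u = (1 - t s) + i s with t and s small and positive.  Let phi(y) be the
    scalar u when y is in A and 1 otherwise.  All values of phi are within
    O(t) of 1, so phi is an eps-representation by unitaries as soon as t is
    small compared to eps.  With mu(A) = tau(1_A), the averaged cocycle
    g(x) = tau_y (phi(xy) phi(y)^* ) is exactly
      g(x) = 1 - t s d(x) + i s h(x),
    where h(x) = mu(x^-1 A) - mu(A) is the defect of invariance of mu on A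
    and d(x) = mu({y | exactly one of xy and y is in A}) lies in [0, 1].

    Take for Phi the vector state of a unit vector v.  If the equality in the
    statement held for every x, then g(x) = <psi(x) v, v>, so g would be a
    positive definite function.  Testing positivity at 1 and x gives
    h(x^-1) = - h(x); testing it at 1, x, xz with coefficients of sum zero
    kills the constant term 1 of g, and what remains, divided by s, says
    h(x) + h(z) <= h(xz) + 2t (positive_definite_almost_subadditive).

    It remains to choose A, x, z, before t, so that h(x) + h(z) > h(xz).
    Otherwise h is superadditive for every A, hence n h(x) <= h(x^n) <= 1 for
    all n and h <= 0 for every A and x (exists_not_superadditive_drift).  But
    h <= 0 contradicts the paradoxical decomposition (exists_drift_gt0):
    picking a representative in each coset of the free subgroup attaches a
    reduced word to every y, and the sets of all y whose word starts with a
    given letter (starts_with) are disjoint, while for each generator s the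
    translate s^-1 A_s of the piece of s covers the complement of the piece
    of s^-1.  Two generators thus give a total mean of at least 2. *)

Set Implicit Arguments.
Unset Strict Implicit.
Unset Printing Implicit Defensive.

Import Order.TTheory GRing.Theory Num.Theory numFieldNormedType.Exports.

Local Open Scope classical_set_scope.
Local Open Scope ring_scope.

(** * First letters in a group with a free family *)

Section FirstLetter.
Variable G : groupType.
Implicit Types (l m : bool * G) (w : seq (bool * G)) (S : set G).

Definition letter_inv l := (~~ l.1, l.2).

Lemma letter_invK : involutive letter_inv.
Proof. by case=> b s; rewrite /letter_inv /= negbK. Qed.

Lemma letter_inv_eq l m : l.2 = m.2 -> l.1 != m.1 -> letter_inv l = m.
Proof. by case: l m => -[] s [[] t] //= ->. Qed.

Lemma letter_valV l : letter_val (letter_inv l) = ((letter_val l)^-1)%g.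
Proof. by case: l => -[] s; rewrite /letter_val /= ?invgK. Qed.

(** The concatenation of the inverse of a reduced word with a reduced word
    creates a cancellation only at the junction, between two equal first
    letters.  The inverse word is the reversal of the inverted letters, so the
    concatenation is a catrev, on which one can induct directly. *)
Lemma reduced_catrev w1 w2 : reduced w1 -> reduced w2 ->
  (forall l m, ohead w1 = Some l -> ohead w2 = Some m -> l != m) ->
  reduced (catrev [seq letter_inv l | l <- w1] w2).
Proof.
elim: w1 w2 => [//|l w1 IHw] w2 /= red1 red2 heads.
apply: IHw; first exact: path_sorted red1.
  case: w2 red2 heads => [//|m w2] /= red2 /(_ _ _ erefl erefl).
  rewrite /reduced /= => neq_lm; rewrite [path _ _ _]red2 andbT.
  move: neq_lm; apply: contraNN => /andP[/eqP eq2 neq1].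
  by apply/eqP; rewrite -[LHS]letter_invK; exact: letter_inv_eq.
move=> m _ head_m [<-]; case: w1 red1 head_m => [//|k w1] /= + [<-].
rewrite /reduced /= => /andP[+ _]; apply: contraNneq => ->.
by rewrite /= eqxx; case: (l.1).
Qed.

Lemma word_val_catrev w1 w2 :
  word_val (catrev [seq letter_inv l | l <- w1] w2)
  = ((word_val w1)^-1 * word_val w2)%g.
Proof.
elim: w1 w2 => [|l w1 IHw] w2 /=; first by rewrite invg1 mul1g.
by rewrite IHw /= letter_valV invgM mulgA.
Qed.

(** If the first letters differed, the inverse of one word followed by the
    other would be a nonempty reduced word with trivial value. *)
Lemma free_family_ohead S w1 w2 : free_family S ->
  word_over S w1 -> word_over S w2 -> reduced w1 -> reduced w2 ->
  word_val w1 = word_val w2 -> ohead w1 = ohead w2.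
Proof.
move=> freeS S1 S2 red1 red2 eq12; apply: contrapT => neq12.
pose w := catrev [seq letter_inv l | l <- w1] w2.
apply: (freeS w).
- move=> l; rewrite /w catrevE mem_cat mem_rev => /orP[/mapP[m m1 ->]|/S2//].
  exact: (S1 m m1).
- apply: reduced_catrev => // l m h1 h2; apply/eqP => eq_lm.
  by apply: neq12; rewrite h1 h2 eq_lm.
- apply/eqP => w0; apply: neq12; have := congr1 size w0.
  by rewrite /w catrevE size_cat size_rev size_map; case: (w1) (w2) => [[]|].
by rewrite word_val_catrev eq12 mulVg.
Qed.

Lemma reduced_word S w : word_over S w ->
  exists w', [/\ word_over S w', reduced w' & word_val w' = word_val w].
Proof.
elim: w => [|l w IHw] Sw /=; first by exists [::].
have [|w' [Sw' redw' <-]] := IHw.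
  by move=> m mw; apply: Sw; rewrite inE mw orbT.
have Slw' : word_over S (l :: w').
  by move=> m; rewrite inE => /predU1P[->|/Sw'//]; apply: Sw; rewrite mem_head.
have [red|] := boolP (reduced (l :: w')); first by exists (l :: w').
case: w' Sw' redw' {Slw'} => [//|m w'] Sw' redw'.
rewrite /reduced /= [path _ _ _]redw' andbT negbK => /andP[/eqP eq2 neq1].
exists w'; split=> /=; first by move=> k kw; apply: Sw'; rewrite inE kw orbT.
  exact: path_sorted redw'.
suff -> : letter_val m = ((letter_val l)^-1)%g by rewrite mulVKg.
by rewrite -letter_valV (letter_inv_eq eq2).
Qed.

(** The predicate only depends on the coset of y under the subgroup generated
    by S, so this choice is constant on each coset. *)
Definition coset_rep S (y : G) : G :=
  xget 1%g [set z | exists2 w, word_over S w & y = (word_val w * z)%g].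

Lemma coset_repP S y :
  exists w, [/\ word_over S w, reduced w & y = (word_val w * coset_rep S y)%g].
Proof.
have [|w Sw yE] := @xgetPex _ 1%g
    [set z | exists2 w, word_over S w & y = (word_val w * z)%g].
  by exists y, [::] => //; rewrite mul1g.
by have [w' [Sw' red eqw]] := reduced_word Sw; exists w'; rewrite eqw.
Qed.

Lemma coset_rep_letter S l y : S l.2 ->
  coset_rep S (letter_val l * y)%g = coset_rep S y.
Proof.
have sub m x z : S m.2 -> (exists2 w, word_over S w & x = (word_val w * z)%g) ->
    exists2 w, word_over S w & (letter_val m * x = word_val w * z)%g.
  move=> Sm [w Sw ->]; exists (m :: w); last by rewrite /= mulgA.
  by move=> k; rewrite inE => /predU1P[->//|/Sw].
move=> Sl; congr (xget _ _); apply/seteqP; split=> z /=; last exact: sub.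
move=> /(sub (letter_inv l) _ _ Sl); rewrite letter_valV mulKg; exact.
Qed.

(** The pieces of the paradoxical decomposition. *)
Definition starts_with S l : set G := [set y | exists w,
  [/\ word_over S (l :: w), reduced (l :: w)
    & y = (word_val (l :: w) * coset_rep S y)%g]].

Lemma starts_with_inj S l m y : free_family S ->
  starts_with S l y -> starts_with S m y -> l = m.
Proof.
move=> freeS [w1 [S1 red1 eq1]] [w2 [S2 red2 eq2]].
suff [] : ohead (l :: w1) = ohead (m :: w2) by [].
apply: (free_family_ohead freeS S1 S2 red1 red2).
by apply: (mulIg (coset_rep S y)); rewrite -eq1.
Qed.

(** Left multiplication by l prepends l to the reduced word of y, except when
    this word starts with the inverse of l.  Hence the piece of l^-1 and the
    preimage under l of the piece of l cover the whole group. *)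
Lemma starts_with_letter S l y : S l.2 -> ~ starts_with S (letter_inv l) y ->
  starts_with S l (letter_val l * y)%g.
Proof.
move=> Sl ny; have [w [Sw redw yE]] := coset_repP S y.
exists w; split.
- by move=> m; rewrite inE => /predU1P[->//|/Sw].
- case: w Sw redw yE => [//|m w] Sw redw yE.
  rewrite /reduced /= [path _ _ _]redw andbT.
  apply/negP => /andP[/eqP eq2 neq1].
  by apply: ny; exists w; rewrite (letter_inv_eq eq2).
by rewrite coset_rep_letter //= -mulgA -yE.
Qed.

(** All letters over at most one generator commute. *)
Lemma nonabelian_two_generators S : nonabelian (generated_subgroup S) ->
  exists a b, [/\ S a, S b & a <> b].
Proof.
move=> [x [y [[u Su <-] [v Sv <-] ncomm]]].
apply: contrapT => noab; apply: ncomm.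
have eqS a b : S a -> S b -> a = b.
  by move=> Sa Sb; apply: contrapT => neq; apply: noab; exists a, b.
have comm_letters l m : S l.2 -> S m.2 -> commute (letter_val l) (letter_val m).
  move=> Sl Sm; have e := eqS _ _ Sl Sm.
  case: l m e {Sl Sm} => [c s] [d t] /= ->.
  rewrite /letter_val /=.
  by case: c; case: d; rewrite /commute /= ?mulVg ?mulgV.
have comm_word l w : S l.2 -> word_over S w ->
    commute (letter_val l) (word_val w).
  move=> Sl; elim: w => [|m w IHw] Sw /=; first exact: commute1.
  apply: commuteM.
    by apply: comm_letters => //; apply: Sw; rewrite mem_head.
  by apply: IHw => k kw; apply: Sw; rewrite inE kw orbT.
elim: u Su => [|l u IHu] Su /=; first by rewrite mul1g mulg1.
apply/commute_sym/commuteM; apply: commute_sym.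
  by apply: comm_word => //; apply: Su; rewrite mem_head.
by apply: IHu => k ku; apply: Su; rewrite inE ku orbT.
Qed.

End FirstLetter.

(** * Failure of invariance of a state *)

Section Mean.
Variables (R : realType) (G : groupType).
Implicit Types (A : set G) (x y z : G).
Local Open Scope complex_scope.

Lemma indicator_bounded A :
  (fun y => `[< A y >]%:R) \in @bounded_function G R.
Proof.
by apply/asboolP; exists 1 => y; rewrite normr_nat lern1; case: asbool.
Qed.

Definition indicator A : linf G R := MkLinf (indicator_bounded A).

Lemma linfE :
  (forall (f g : linf G R) y, (f + g) y = f y + g y)
  * (forall (f : linf G R) y, (- f) y = - f y)
  * (forall a (f : linf G R) y, (a *: f) y = a * f y)
  * (forall y, (1 : linf G R) y = 1)
  * (forall A y, indicator A y = `[< A y >]%:R).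
Proof. by []. Qed.

Definition translate x A : set G := [set y | A (x * y)%g]%classic.

Variables (tau : {scalar (linf G R)}) (htau : is_state tau).

Definition mean A : R := complex.Re (tau (indicator A)).

(** Its vanishing for all A and x is left invariance of the mean. *)
Definition drift A x : R := mean (translate x A) - mean A.

Lemma state_le (f g : linf G R) : (forall y, f y <= g y) -> tau f <= tau g.
Proof.
move=> le_fg; rewrite -subr_ge0 -linearB; apply: (htau.1 (g - f)) => y.
by rewrite !linfE subr_ge0.
Qed.

Lemma state_indicator A : tau (indicator A) = (mean A)%:C.
Proof.
have : 0 <= tau (indicator A) by apply: htau.1 => y; rewrite ler0n.
by move=> /ger0_real /RRe_real.
Qed.

Lemma mean_ge0 A : 0 <= mean A.
Proof.
by rewrite -lecR -state_indicator; apply: htau.1 => y; rewrite ler0n.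
Qed.

Lemma mean_le1 A : mean A <= 1.
Proof.
rewrite -lecR -state_indicator -[X in _ <= X]htau.2; apply: state_le => y.
by rewrite !linfE lern1; case: asbool.
Qed.

Lemma translate1 A : translate 1%g A = A.
Proof. by apply/seteqP; split=> y; rewrite /translate /= mul1g. Qed.

(** If no drift is positive then, for every s in S, the pieces of s and s^-1
    have total mean at least 1.  Two distinct generators give four disjoint
    pieces of total mean at least 2. *)
Lemma exists_drift_gt0 : contains_nonabelian_free_group G ->
  exists A x, 0 < drift A x.
Proof.
case=> F [S freeS ->] /nonabelian_two_generators[a [b [Sa Sb neq_ab]]].
apply: contrapT => nodrift.
have drift_le0 A x : mean (translate x A) <= mean A.
  by rewrite leNgt -subr_gt0; apply/negP => gt0; apply: nodrift; exists A, x.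
pose A (l : bool * G) := starts_with S l.
have half s : S s -> 1 <= mean (A (true, s)) + mean (A (false, s)).
  move=> Ss; have le1 := drift_le0 (A (false, s)) s.
  apply: le_trans (lerD (lexx _) le1).
  rewrite -lecR rmorphD /= -2!state_indicator -linearD.
  rewrite -[X in X <= _]htau.2; apply: state_le => y.
  rewrite !linfE -natrD ler1n addn_gt0 !lt0b.
  have [//|ny] := asboolP (A (true, s) y); apply/asboolP.
  exact: (@starts_with_letter _ _ (false, s)).
have sum4 : mean (A (true, a)) + mean (A (false, a))
    + (mean (A (true, b)) + mean (A (false, b))) <= 1.
  rewrite -lecR !rmorphD /= -4!state_indicator -!linearD.
  rewrite -[X in _ <= X]htau.2; apply: state_le => y.
  rewrite !linfE -!natrD lern1.
  have inj l m : A l y -> A m y -> l = m by exact: starts_with_inj freeS.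
  have disjoint_ab c d : A (c, a) y -> A (d, b) y -> False.
    by move=> ca db; case: (inj _ _ ca db).
  have disjoint_inv s : A (true, s) y -> A (false, s) y -> False.
    by move=> ts fs; case: (inj _ _ ts fs).
  have count (P Q P' Q' : Prop) : (P -> Q -> False) -> (P' -> Q' -> False) ->
      (P -> P' -> False) -> (P -> Q' -> False) -> (Q -> P' -> False) ->
      (Q -> Q' -> False) ->
      (`[< P >] + `[< Q >] + (`[< P' >] + `[< Q' >]) <= 1)%N.
    by move=> *; do 4 case: asboolP => ?; rewrite //=; exfalso; tauto.
  by apply: count; (apply: disjoint_ab || apply: disjoint_inv).
have := half a Sa; have := half b Sb; lra.
Qed.

(** A superadditive drift is at least n times its value at x on the n-th power
    of x; as it is bounded by 1, it cannot be positive at x. *)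
Lemma exists_not_superadditive_drift : contains_nonabelian_free_group G ->
  exists A x z, drift A x + drift A z > drift A (x * z)%g.
Proof.
move=> /exists_drift_gt0[A [x drift_x]]; apply: contrapT => nodefect.
have superadd y z : drift A y + drift A z <= drift A (y * z)%g.
  by rewrite leNgt; apply/negP => gt; apply: nodefect; exists A, y, z.
have power n : n%:R * drift A x <= drift A (x ^+ n)%g.
  elim: n => [|n IHn]; first by rewrite mul0r expg0 /drift translate1 subrr.
  rewrite expgS -natr1 mulrDl mul1r addrC.
  by apply: le_trans (superadd _ _); rewrite lerD2l.
have [n] : exists n : nat, (drift A x)^-1 < n%:R.
  exists (Num.bound (drift A x)^-1).
  by apply: archi_boundP; rewrite invr_ge0 ltW.
rewrite -(ltr_pM2r drift_x) mulVf ?gt_eqF// => gt1.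
have := power n; have := mean_le1 (translate (x ^+ n)%g A); have := mean_ge0 A.
rewrite /drift in gt1 *; lra.
Qed.

End Mean.

(** * Scalar operators and vector states *)

Section ScalarOperators.
Variables (R : realType) (H : hilbertType R).
Implicit Types (a b : R[i]) (T : Bop H) (u v : H).

Lemma innerZl a u v : ⟨a *: u, v⟩ = a * ⟨u, v⟩.
Proof. exact: linearZl_LR. Qed.

Lemma innerZr a u v : ⟨u, a *: v⟩ = a^* * ⟨u, v⟩.
Proof. exact: linearZr_LR. Qed.

Lemma adjoint_eq T (S : Bop H) :
  (forall u v, ⟨T u, v⟩ = ⟨u, S v⟩) -> adjoint T = S.
Proof.
move=> TS; apply: xget_unique => // S' TS'.
apply: val_inj; apply/funext => v; apply/eqP; rewrite -subr_eq0; set w := _ - _.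
have w0 : ⟨w, w⟩ = 0.
  by rewrite {2}/w linearB /= -TS -TS' subrr.
by move: w0; rewrite inner_norm => /eqP; rewrite sqrf_eq0 normr_eq0.
Qed.

Lemma adjoint_scalar a : adjoint (a *: (1 : Bop H)) = a^* *: (1 : Bop H).
Proof.
by apply: adjoint_eq => u v; rewrite /= innerZl innerZr conjCK.
Qed.

Lemma scalar_opM a T : a *: (1 : Bop H) * T = a *: T.
Proof. exact: val_inj. Qed.

Lemma scalar_op_unitary a : `|a| = 1 -> unitary (a *: (1 : Bop H)).
Proof.
move=> a1; have aa : a * a^* = 1 by rewrite -normCK a1 expr1n.
by split; rewrite adjoint_scalar scalar_opM scalerA ?[_^* * _]mulrC aa scale1r.
Qed.

Lemma opnorm_scalar a : opnorm (a *: (1 : Bop H)) <= complex.Re `|a|.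
Proof.
apply: ge_sup.
  by exists (complex.Re `|(a *: (1 : Bop H)) 0|), 0 => //=; rewrite normr0.
move=> _ [v /= v1 <-]; suff : `|a *: v| <= `|a| by rewrite lecE => /andP[].
by rewrite normrZ ler_piMr.
Qed.

(** The functional Phi of the theorem, for a unit vector v. *)
Definition vector_state v (T : Bop H) : R[i] := ⟨T v, v⟩.

Lemma vector_state_linear v : scalar (vector_state v).
Proof. by move=> a S T; rewrite /vector_state /= linearPl. Qed.

HB.instance Definition _ v :=
  GRing.isLinear.Build _ _ _ _ (vector_state v) (vector_state_linear v).

Lemma vector_stateZ v a T : vector_state v (a *: T) = a * vector_state v T.
Proof. exact: innerZl. Qed.

Lemma series_head (V : zmodType) (f : nat -> V) n :
  (forall k, f k.+1 = 0) -> series f n.+1 = f 0%N.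
Proof.
by move=> f0; rewrite /series /= big_nat_recl // big1 ?addr0.
Qed.

(** Pads v with zeros, so that the ultraweak functional given by the pair
    (head_seq v, head_seq v) is the vector state of v. *)
Definition head_seq v : nat -> H := fun k => if k is 0 then v else 0.

Lemma head_seq_ell2 v : cvgn (series (fun k => `|head_seq v k| ^+ 2 : R[i]^o)).
Proof.
apply: (is_cvg_near_cst (`|v| ^+ 2 : R[i]^o)); exists 1%N => // -[//|n] _.
by rewrite series_head //= => k; rewrite normr0 expr0n.
Qed.

(** The ultraweak topology is finer than the initial topology of each of these
    functionals. *)
Lemma ell2_functional_continuous (p : ell2_pair H) :
  continuous (ell2_functional p : ultraweak H -> R[i]^o).
Proof.
move=> T.
have cvgT := (cvg_sup _ _ _).1 (@cvg_id _ (nbhs (T : ultraweak H))) p.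
have c := @initial_continuous (Bop H) (R[i]^o) (ell2_functional p) T.
by apply: cvg_trans c; apply: cvg_app; exact: cvgT.
Qed.

Lemma ell2_functional_head v :
  ell2_functional (MkEll2Pair (@head_seq_ell2 v) (@head_seq_ell2 v))
  = vector_state v.
Proof.
apply/funext => T; apply/cvg_lim => //; apply: cvg_near_cst.
exists 1%N => // -[//|n] _; rewrite series_head //= => k.
by rewrite linear0.
Qed.

Lemma normal_vector_state v : normal_functional (vector_state v).
Proof.
move=> T.
have := @ell2_functional_continuous
  (MkEll2Pair (@head_seq_ell2 v) (@head_seq_ell2 v)) T.
by rewrite ell2_functional_head.
Qed.

End ScalarOperators.

(** * Positive definite functions *)

Section PositiveDefiniteFunctions.
Variables (R : realType) (G : groupType).
Local Open Scope complex_scope.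

Definition positive_definite_function (g : G -> R[i]) : Prop :=
  forall n (x : 'I_n -> G) (c : 'I_n -> R[i]), injective x ->
    0 <= \sum_i \sum_j c j * (c i)^*%C * g ((x i)^-1 * x j)%g.

Lemma conj_conjc (a : R[i]) : Num.conj a = a^*%C.
Proof. by []. Qed.

Lemma BopZ (H : hilbertType R) (T : Bop H) (a : R[i]) (v : H) :
  T (a *: v) = a *: T v.
Proof.
have T0 : T 0 = 0.
  by have := Bop_linear T (-1) 0 0; rewrite scaler0 addr0 scaleN1r addNr.
by have := Bop_linear T a v 0; rewrite T0 !addr0.
Qed.

(** The positivity of the operator matrix is tested on the vectors
    (c_1 v, ..., c_n v). *)
Lemma positive_definite_vector_state (H : hilbertType R) (psi : G -> Bop H)
    (v : H) :
  positive_definite psi ->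
  positive_definite_function (fun x => vector_state v (psi x)).
Proof.
move=> pd n x c injx; have := pd n x injx (fun i => c i *: v).
congr (0 <= _); apply: eq_bigr => i _.
rewrite linear_sumlz; apply: eq_bigr => j _.
by rewrite mxE [LHS]innerZr BopZ innerZl -conj_conjc mulrCA mulrA /vector_state.
Qed.

(** A positive definite function whose real part differs from 1 only to second
    order has a nearly additive first-order imaginary part.  The combinations of
    point masses used as test vectors have coefficients of sum zero, so that
    the term 1 of g contributes nothing and everything left is divisible by
    s. *)
Lemma positive_definite_almost_subadditive (g : G -> R[i]) (d h : G -> R)
    (s t : R) :
  positive_definite_function g ->
  (forall x, g x = (1 - t * s * d x) +i* (s * h x)) ->
  0 < s -> 0 <= t -> (forall x, 0 <= d x <= 1) -> d 1%g = 0 -> h 1%g = 0 ->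
  forall x z, h x + h z <= h (x * z)%g + 2 * t.
Proof.
move=> pd gE s0 t0 d01 d1 h1 x z.
(* Coefficients 1, -1 at the points 1, y: the form is real, hence its
   imaginary part s (h y + h y^-1) vanishes. *)
have hV y : h y + h y^-1%g = 0.
  have [->|y1] := eqVneq y 1%g; first by rewrite invg1 h1 addr0.
  pose p (i : 'I_2) := nth 1%g [:: 1%g; y] i.
  pose c (i : 'I_2) : R[i] := nth 0 [:: 1; -1] i.
  have injp : injective p.
    move=> i j /eqP; rewrite nth_uniq //= ?inE 1?eq_sym ?y1 //.
    by move=> /eqP/val_inj.
  have := pd 2 p c injp; rewrite !big_ord_recl !big_ord0 /p /c /=.
  rewrite !invg1 !mul1g !mulg1 mulVg !gE d1 h1.
  simpc => /andP[/eqP hy _].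
  apply: (mulfI (lt0r_neq0 s0)); rewrite mulr0; lra.
have dt y : t * d y <= t by have /andP[d0 d1'] := d01 y; rewrite ler_piMr.
(* The points 1, x, x z must be distinct; when they are not, the bound
   follows from h 1 = 0 and the antisymmetry of h. *)
have [->|x1] := eqVneq x 1%g; first by rewrite mul1g h1 add0r lerDl mulr_ge0.
have [->|z1] := eqVneq z 1%g; first by rewrite mulg1 h1 addr0 lerDl mulr_ge0.
have [xz1|xz1] := eqVneq (x * z)%g 1%g.
  by rewrite xz1 h1 -(mulg1_eq xz1) hV add0r mulr_ge0.
(* The coefficients 1, i, -1 - i have sum zero and equal oriented areas
   Im (c_(j+1) conj c_j) = 1 (indices mod 3), so the h terms add up to a
   multiple of h x + h z - h (x z). *)
pose p (i : 'I_3) := nth 1%g [:: 1; x; x * z]%g i.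
pose c (i : 'I_3) : R[i] := nth 0 [:: 1; 0 +i* 1; (-1) +i* (-1)] i.
have injp : injective p.
  move=> i j /eqP; rewrite nth_uniq //= ?inE => [/eqP/val_inj//|].
  rewrite ![1%g == _]eq_sym (negPf x1) (negPf xz1) andbT /=.
  by rewrite -{1}[x]mulg1 (inj_eq (mulgI x)) eq_sym.
have := pd 3 p c injp; rewrite !big_ord_recl !big_ord0 /p /c /=.
have -> : ((x * z)^-1 * x)%g = z^-1%g by rewrite invgM mulgVK.
rewrite !invg1 !mul1g !mulg1 !mulVg mulKg !gE d1 h1.
simpc => /andP[_ hxz].
have : 0 <= s * (t * d z + t * d z^-1%g + t * d (x * z)%g + t * d (x * z)^-1%g
    - 2 * (h x + h z - h (x * z)%g)).
  have hN y : h y^-1%g = - h y by apply/eqP; rewrite -addr_eq0 addrC hV.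
  by move: hxz; rewrite !hN; congr (0 <= _); ring.
rewrite pmulr_rge0 //.
have := dt z; have := dt z^-1%g; have := dt (x * z)%g; have := dt (x * z)^-1%g.
lra.
Qed.

End PositiveDefiniteFunctions.

(** * A perturbation of the trivial character *)

Section Phase.
Variables (R : realType) (G : groupType).
Implicit Types (A : set G) (t : R) (x y : G).
Local Open Scope complex_scope.

(** With s = 2 t / (1 + t^2), the point (1 - t s) + i s is the
    stereographic parametrization (1 + i t) / (1 - i t) of the unit circle.  It
    makes the deviation from 1 of the real part exactly t times the imaginary
    part. *)
Definition chord t : R := 2 * t / (1 + t ^+ 2).

Definition phase t A y : R[i] :=
  if `[< A y >] then (1 - t * chord t) +i* chord t else 1.

Lemma chord_gt0 t : 0 < t -> 0 < chord t.
Proof. by move=> t0; rewrite divr_gt0 ?mulr_gt0 // ltr_wpDr // sqr_ge0. Qed.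

Lemma phase_circle t : (1 - t * chord t) ^+ 2 + chord t ^+ 2 = 1.
Proof.
have t2 : 1 + t ^+ 2 != 0 by rewrite gt_eqF // ltr_wpDr // sqr_ge0.
by rewrite /chord; field.
Qed.

Lemma norm_phase t A y : `|phase t A y| = 1.
Proof.
rewrite /phase; case: asboolP => _; last exact: normr1.
by rewrite normc_def /= phase_circle sqrtr1.
Qed.

Lemma phase_near1 t A y : 0 < t -> t <= 1 -> `|phase t A y - 1| <= (4 * t)%:C.
Proof.
move=> t0 t1; rewrite /phase; case: asboolP => _; last first.
  by rewrite subrr normr0 lecR mulr_ge0 // ltW.
have s0 := chord_gt0 t0.
have s2t : chord t <= 2 * t.
  rewrite ler_pdivrMr ?ltr_wpDr ?sqr_ge0 // ler_peMr //; first lra.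
  by rewrite lerDl sqr_ge0.
have -> : (1 - t * chord t) +i* chord t - 1
    = (- (t * chord t))%:C + 'i%C * (chord t)%:C.
  by apply/eqP; rewrite eq_complex /=; apply/andP; split; apply/eqP; ring.
apply: (le_trans (ler_normD _ _)); rewrite normrM.
rewrite !normc_def /= !expr0n /= !addr0 !add0r expr1n !sqrtr1 !sqrtr_sqr mul1r.
rewrite -rmorphD lecR normrN (gtr0_norm s0) (gtr0_norm (mulr_gt0 t0 s0)).
have : t * chord t <= chord t by apply: ler_piMl => //; exact: ltW.
lra.
Qed.

(** Three phases, each within 4 t of 1. *)
Lemma phase_near_multiplicative t A x y : 0 < t -> t <= 1 ->
  `|phase t A (x * y)%g - phase t A x * phase t A y| <= (12 * t)%:C.
Proof.
move=> t0 t1; set a := phase t A.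
have -> : a (x * y)%g - a x * a y
    = (a (x * y)%g - 1) - ((a x - 1) + a x * (a y - 1)) by ring.
have near z : `|a z - 1| <= (4 * t)%:C by exact: phase_near1.
apply: (le_trans (ler_normB _ _)).
have -> : (12 * t)%:C = (4 * t)%:C + ((4 * t)%:C + (4 * t)%:C).
  by rewrite -!rmorphD /=; congr (_%:C); ring.
apply: lerD => //; apply: (le_trans (ler_normD _ _)).
by apply: lerD => //; rewrite normrM norm_phase mul1r.
Qed.

Definition shifted_difference A x : set G := [set y | ~ (A (x * y)%g <-> A y)].

(** The bounded function y |-> phase (x y) (phase y)^*, written through
    indicators so that its state can be computed by linearity
    (phase_ratioE). *)
Definition phase_ratio t A x : linf G R :=
  1 - (t * chord t)%:C *: indicator R (shifted_difference A x)
  + (0 +i* chord t) *: (indicator R (translate x A) - indicator R A).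

Lemma phase_ratioE t A x y :
  phase_ratio t A x y = phase t A (x * y)%g * (phase t A y)^*%C.
Proof.
rewrite /phase_ratio !linfE /phase /translate /shifted_difference /=.
case: (asboolP (A (x * y)%g)) => Axy; case: (asboolP (A y)) => Ay.
- rewrite asboolF; last by tauto.
  apply/eqP; rewrite eq_complex /=.
  have := phase_circle t; rewrite !expr2 => e.
  by apply/andP; split; apply/eqP; lra.
- rewrite asboolT; last by tauto.
  by apply/eqP; rewrite eq_complex /=; apply/andP; split; apply/eqP; ring.
- rewrite asboolT; last by tauto.
  by apply/eqP; rewrite eq_complex /=; apply/andP; split; apply/eqP; ring.
rewrite asboolF; last by tauto.
by apply/eqP; rewrite eq_complex /=; apply/andP; split; apply/eqP; ring.
Qed.

Lemma state_phase_ratio (tau : {scalar (linf G R)}) t A x : is_state tau ->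
  tau (phase_ratio t A x)
  = (1 - t * chord t * mean tau (shifted_difference A x))
    +i* (chord t * drift tau A x).
Proof.
move=> htau; have tauZ a f : tau (a *: f) = a * tau f by exact: linearZ.
have tauB f g : tau (f - g) = tau f - tau g by exact: linearB.
rewrite /phase_ratio linearD tauB !tauZ tauB !state_indicator // htau.2 /drift.
by apply/eqP; rewrite eq_complex /=; apply/andP; split; apply/eqP; ring.
Qed.

End Phase.

Lemma positive_definite_state_phase (R : realType) (G : groupType)
    (tau : {scalar (linf G R)}) (A : set G) (t : R) :
  is_state tau -> 0 < t ->
  positive_definite_function (fun x => tau (phase_ratio t A x)) ->
  forall x z, drift tau A x + drift tau A z <= drift tau A (x * z)%g + 2 * t.
Proof.
move=> htau t0 pd.
apply: (positive_definite_almost_subadditive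
  (d := fun x => mean tau (shifted_difference A x)) (s := chord t) pd)
  => [x| | |x| |].
- exact: state_phase_ratio.
- exact: chord_gt0.
- exact: ltW.
- by rewrite mean_ge0 // mean_le1.
- suff -> : shifted_difference A 1%g = set0.
    have -> : mean tau set0 = complex.Re (tau 0).
      congr (complex.Re (tau _)); apply: val_inj; apply/funext => y /=.
      by rewrite asboolF.
    by rewrite linear0.
  by apply/seteqP; split=> y //; rewrite /shifted_difference /= mul1g; apply.
- by rewrite /drift translate1 subrr.
Qed.

Theorem proposition1p5 (R : realType) (G : groupType)
    (hG : contains_nonabelian_free_group G)
    (tau : {scalar (linf G R)}) (htau : is_state tau)
    (H : hilbertType R) (hH : exists v : H, v != 0) :
  exists2 eps0 : R, 0 < eps0 & forall eps : R, 0 < eps < eps0 ->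
  exists phi : G -> Bop H,
    [/\ eps_representation eps phi, (forall x, unitary (phi x)) &
    forall psi : G -> Bop H, positive_definite psi ->
    exists2 Phi : {scalar (Bop H)}, normal_functional Phi &
    exists (x : G) (f : linf G R),
      (forall y : G,
         f y = Phi (adjoint (phi x) * phi (x * y)%g * adjoint (phi y))) /\
      Phi (adjoint (phi x) * psi x) <> tau f].
Proof.
(* The construction works for every eps > 0, so 1 is an arbitrary eps0. *)
exists 1 => // eps /andP[eps0 _].
have [A [x [z gap]]] := exists_not_superadditive_drift htau hG.
have [v v1] : exists v : H, ⟨v, v⟩ = 1.
  have [v v0] := hH; exists (`|v|^-1 *: v).
  rewrite inner_norm normrZ normrV ?unitfE ?normr_eq0 // normr_id.
  by rewrite mulVf ?expr1n ?normr_eq0.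
(* 12 t bounds the multiplicativity defect of the phase, and 2 t the error of
   subadditivity in positive_definite_state_phase. *)
have [t [t0 t1 t_eps t_gap]] : exists t : R, [/\ 0 < t, t <= 1, 12 * t <= eps &
    2 * t < drift tau A x + drift tau A z - drift tau A (x * z)%g].
  set gap' := _ - drift _ _ (x * z)%g.
  have gap'0 : 0 < gap' by rewrite subr_gt0.
  exists (Num.min 1 (Num.min (eps / 12) (gap' / 4))).
  split; rewrite ?lt_min ?ltr01 ?ge_min ?lexx ?divr_gt0 //.
    have : Num.min 1 (Num.min (eps / 12) (gap' / 4)) <= eps / 12.
      by rewrite !ge_min lexx orbT.
    lra.
  have : Num.min 1 (Num.min (eps / 12) (gap' / 4)) <= gap' / 4.
    by rewrite !ge_min lexx !orbT.
  lra.
pose a := phase t A.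
exists (fun y => a y *: (1 : Bop H)); split.
- move=> y w; rewrite scalar_opM scalerA -scalerBl.
  apply: (le_trans (opnorm_scalar _ _)).
  apply: le_trans t_eps.
  by have := phase_near_multiplicative A y w t0 t1; rewrite lecE => /andP[].
- by move=> y; apply: scalar_op_unitary; exact: norm_phase.
move=> psi pd; exists (vector_state v); first exact: normal_vector_state.
apply: contrapT => agree.
suff pd_ratio : positive_definite_function (fun y => tau (phase_ratio t A y)).
  have := positive_definite_state_phase htau t0 pd_ratio x z.
  by rewrite leNgt -ltrBrDl t_gap.
suff -> : (fun y => tau (phase_ratio t A y))
    = (fun y => vector_state v (psi y)).
  exact: positive_definite_vector_state.
apply/funext => y; apply: contrapT => differ; apply: agree.
exists y, ((a y)^* *: phase_ratio t A y); split.
  move=> w.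
  have -> : ((a y)^* *: phase_ratio t A y) w
      = (a y)^* * phase_ratio t A y w by [].
  rewrite phase_ratioE !adjoint_scalar scalar_opM scalerA scalar_opM scalerA.
  by rewrite [RHS]vector_stateZ /vector_state v1 mulr1 mulrA.
rewrite adjoint_scalar scalar_opM [LHS]vector_stateZ linearZ => /mulfI eq_at.
apply: differ; apply/esym/eq_at.
by rewrite conjC_eq0 -normr_eq0 norm_phase oner_eq0.
Qed.
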